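(* Let $(G_n)_{n\ge 1}$ be a sequence of finite groups such that $\lim_{n \to \infty} |G_n| = \infty$. For all $n$, let $C_n = \sqrt{ \Theta(G_n)\, |G_n| \log |G_n| }$. Then for any $\varepsilon > 0$, $$ \lim_{n \to \infty} P(G_n, \lceil (1+\varepsilon) C_n \rceil ) = 1 \quad\text{and}\quad \lim_{n \to \infty} P(G_n, \lfloor (1-\varepsilon) C_n \rfloor ) = 0 . $$
   Context: All logarithms are natural. For a finite group $G$ and $x\in G$, $C(x)=\{g\in G: gx=xg\}$ is the centralizer of $x$. For a finite group $G$ of order $n\ge 2$, $\Theta(G)$ is defined as the unique number $\xi\in[1/2,1]$ satisfying $$ 2 \xi \log n = \log \sum_{x \in G} \exp \Big( \xi \log n \cdot \frac{|C(x)|}{n} \Big) $$ (the function $\xi\mapsto 2\xi\log n-\log\sum_{x}\exp(\xi\log n\,|C(x)|/n)$ is continuous, strictly increasing on $[1/2,1]$, negative at $1/2$ and nonnegative at $1$). For a finite group $G$ and a positive integer $k$, let $a_1,\dots,a_k,b_1,\dots,b_k$ be $2k$ independent uniformly random elements of $G$ (repetitions allowed), $A=\{a_1,\dots,a_k\}$, $B=\{b_1,\dots,b_k\}$, and $AB=\{ab: a\in A, b\in B\}$. Define $P(G,k)=\Pr[AB\cup BA=G]$. *)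

(* Defs.v *)
From HB Require Import structures.
From mathcomp Require Import all_boot all_order all_fingroup all_algebra.
From mathcomp Require Import classical_sets boolp reals exp topology normedtype sequences.
Set Implicit Arguments. Unset Strict Implicit. Unset Printing Implicit Defensive.
Import Order.TTheory GRing.Theory Num.Theory.
Local Open Scope ring_scope.
Local Open Scope classical_set_scope.

Definition Theta_eq (R : realType) (gT : finGroupType) (xi : R) : Prop :=
  let n : R := (#|gT|)%:R in
  2 * xi * ln n = ln (\sum_(x : gT) expR (xi * ln n * ((#|('C[x])%g|)%:R / n))).

(* Theta(G): the (unique, for |G| >= 2) xi in [1/2,1] satisfying Theta_eq.
   (For |G| = 1 this is an arbitrary point of [1/2,1]; irrelevant for limits.) *)
Definition Theta (R : realType) (gT : finGroupType) : R :=
  xget (2^-1 : R) [set xi : R | 2^-1 <= xi <= 1 /\ Theta_eq gT xi].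

Definition covers (gT : finGroupType) (k : nat) (a b : k.-tuple gT) : bool :=
  let A := [set x in a] in
  let B := [set x in b] in
  [set (x * y)%g | x in A, y in B] :|: [set (y * x)%g | x in A, y in B] == [set: gT]%SET.

Definition Pcov (R : realType) (gT : finGroupType) (k : nat) : R :=
  (#|[set ab : k.-tuple gT * k.-tuple gT | covers ab.1 ab.2]|)%:R
    / ((#|gT| ^ (2 * k))%N)%:R.

(* Main.v *)
(** An element [x] is missed by [AB :|: BA] iff every [b_j] avoids the union [U] of
    the sets [{a_i^-1 x, x a_i^-1}], which has conditional probability
    [(1 - |U|/n)^k].  Each of these sets has on average [2 - c x] elements, where
    [c x = |C(x)|/n], and overlaps between different [i] only cost a factor
    [exp(O(k^3/n^2)) = 1 + o(1)], so [x] is missed with probability close to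
    [exp(-L (2 - c x))] for [L = k^2/n].  By definition of [Theta] these numbers
    sum to [1] at [L = Theta log n]; since each exponent is at least [L], the sum
    is a negative power of [n] for [L] larger by a constant factor and a positive
    one for [L] smaller.  The first case is a union bound.  In the second case
    Chebyshev's inequality applies: [x] and [y] are missed almost independently
    unless many [a] conjugate [x] to [y], and each [x] has only [O(log n)] such [y]. *)

Require Import Defs.
From HB Require Import structures.
From mathcomp Require Import all_boot all_order all_fingroup all_algebra.
From mathcomp Require Import classical_sets boolp reals exp topology normedtype sequences.
From mathcomp Require Import realfun ring lra.
Import Order.TTheory GRing.Theory Num.Theory numFieldNormedType.Exports.
Local Open Scope ring_scope.
Local Open Scope classical_set_scope.

(** * Exponential inequalities and sums over tuples *)

(** Since [expR u >= 1 + u], it suffices that [(1 + u) * (1 - u + u ^+ 2) = 1 + u ^+ 3 >= 1]. *)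
Lemma expRN_le {R : realType} {u : R} : 0 <= u -> expR (- u) <= 1 - u + u ^+ 2.
Proof.
move=> u0; rewrite expRN invf_ple ?posrE ?expR_gt0 //; last by nra.
apply: le_trans (expR_ge1Dx u).
rewrite -[leLHS]mul1r ler_pdivrMr; first by nra.
by nra.
Qed.

(** After inversion this rests on [(1 - u) * (1 + u + 2 * u ^+ 2) = 1 + u ^+ 2 * (1 - 2 * u)], which
    is at least 1 for [u <= 1/2]. *)
Lemma expRN_ge {R : realType} {u : R} :
  0 <= u <= 2^-1 -> expR (- u - 2 * u ^+ 2) <= 1 - u.
Proof.
move=> /andP[u0 u2]; rewrite -opprD expRN invf_ple ?posrE ?expR_gt0 //; last by lra.
apply: le_trans (expR_ge1Dx _).
rewrite -[leLHS]mul1r ler_pdivrMr; last by lra.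
have : 0 <= u ^+ 2 * (1 - 2 * u) by apply: mulr_ge0; [exact: sqr_ge0|lra].
by lra.
Qed.

Lemma expR_ge_pow {R : realType} {x : R} (j : nat) :
  0 <= x -> (x / j%:R) ^+ j <= expR x.
Proof.
case: j => [|j] x0; first by rewrite expr0 -expR0 ler_expR.
have -> : expR x = expR (x / j.+1%:R) ^+ j.+1.
  by rewrite -expRM_natr divfK // pnatr_eq0.
apply: lerXn2r; rewrite ?nnegrE ?expR_ge0 ?divr_ge0 //.
by apply: le_trans (expR_ge1Dx _); rewrite lerDr.
Qed.

Lemma sum_tuple_cons {V : nmodType} {T : finType} {k : nat}
    (F : k.+1.-tuple T -> V) :
  \sum_a F a = \sum_x \sum_(a : k.-tuple T) F (cons_tuple x a).
Proof.
rewrite pair_bigA /= (reindex (fun p : T * k.-tuple T => cons_tuple p.1 p.2)) //=.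
exists (fun t => (thead t, behead_tuple t)) => [[x a] _|a _] /=.
  by congr (_, _); apply: val_inj.
by rewrite [RHS]tuple_eta; apply: val_inj.
Qed.

Lemma sum_tuple_prod {R : comPzSemiRingType} {T : finType} (f : T -> R) (k : nat) :
  \sum_(a : k.-tuple T) \prod_(x <- a) f x = (\sum_x f x) ^+ k.
Proof.
elim: k => [|k IHk].
  rewrite (big_pred1 [tuple]) ?big_nil ?expr0 // => a /=.
  by rewrite tuple0; apply/esym/eqP.
rewrite sum_tuple_cons exprS -IHk mulr_suml; apply: eq_bigr => x _.
by rewrite mulr_sumr; apply: eq_bigr => a _; rewrite big_cons.
Qed.

(** * Unions of randomly chosen sets and the probability of avoiding them *)

Definition hit {T S : finType} (D : T -> {set S}) (s : seq T) : {set S} :=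
  (\bigcup_(a <- s) D a)%SET.

Lemma hit_cons {T S : finType} (D : T -> {set S}) (a : T) (s : seq T) :
  hit D (a :: s) = (D a :|: hit D s)%SET.
Proof. by rewrite /hit big_cons. Qed.

Lemma mem_hit {T S : finType} (D : T -> {set S}) (s : seq T) (u : S) :
  (u \in hit D s) = has (fun a => u \in D a) s.
Proof.
by elim: s => [|a s IHs]; rewrite ?hit_cons ?inE ?IHs //= /hit big_nil inE.
Qed.

Lemma card_hit_le {T S : finType} (D : T -> {set S}) (s : seq T) :
  (#|hit D s| <= \sum_(a <- s) #|D a|)%N.
Proof.
elim: s => [|a s IHs]; first by rewrite /hit !big_nil cards0.
rewrite hit_cons big_cons (leq_trans (leq_card_setU _ _)) //.
by rewrite leq_add2l.
Qed.

(** Double counting: each point of [U] lies in at most [r] of the sets [D a]. *)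
Lemma sum_card_setI_le {T S : finType} {D : T -> {set S}} {r : nat} (U : {set S}) :
  (forall u, #|[set a | u \in D a]%SET| <= r)%N ->
  (\sum_a #|D a :&: U| <= r * #|U|)%N.
Proof.
move=> hr.
have cardI a : #|D a :&: U|%SET = (\sum_(u in U) (u \in D a))%N.
  rewrite -sum1_card big_mkcond [RHS]big_mkcond /=.
  by apply: eq_bigr => u _; rewrite inE; case: (u \in D a); case: (u \in U).
under eq_bigr do rewrite cardI.
rewrite exchange_big /= mulnC -sum_nat_const.
apply: leq_sum => u _; rewrite (leq_trans _ (hr u)) //.
rewrite -sum1dep_card [leqRHS]big_mkcond /=.
by apply: leq_sum => a _; case: (u \in D a).
Qed.

(* The entries of [a] are revealed one at a time: meeting the at most [B]
   elements already hit costs at most [t * r * B] in each step's factor. *)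
Lemma occupancy_le {R : realType} {T S : finType} {D : T -> {set S}} {r : nat}
    (B : nat) {t : R} :
  0 <= t -> (forall a, #|D a| <= r)%N ->
  (forall u, #|[set a | u \in D a]%SET| <= r)%N ->
  forall (k : nat) (U : {set S}), (#|U| + r * k <= B)%N ->
  \sum_(a : k.-tuple T) expR (- (t * #|(U :|: hit D a)%SET|%:R)) <=
  expR (- (t * #|U|%:R)) *
  (#|T|%:R * (1 + (t * r%:R) ^+ 2) - t * \sum_a #|D a|%:R
    + t * (r%:R * B%:R)) ^+ k.
Proof.
move=> t0 hD hD'.
set Q := _ + t * (r%:R * B%:R).
have step (U : {set S}) : (#|U| <= B)%N ->
    \sum_a expR (- (t * #|(U :|: D a)%SET|%:R)) <= expR (- (t * #|U|%:R)) * Q.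
  move=> UB.
  have cardU a : #|(U :|: D a)%SET|%:R = #|U|%:R + (#|D a|%:R - #|D a :&: U|%:R) :> R.
    rewrite cardsU finset.setIC natrB ?natrD; first by rewrite addrA.
    by rewrite (leq_trans (subset_leq_card (subsetIl _ _))) // leq_addl.
  have le1 a : expR (- (t * #|(U :|: D a)%SET|%:R)) <= expR (- (t * #|U|%:R)) *
      (1 + (t * r%:R) ^+ 2 - t * #|D a|%:R + t * #|D a :&: U|%:R).
    rewrite cardU mulrDr opprD expRD ler_wpM2l ?expR_ge0 //.
    set e := _ - _.
    have e0 : 0 <= e by rewrite subr_ge0 ler_nat subset_leq_card // subsetIl.
    apply: le_trans (expRN_le (mulr_ge0 t0 e0)) _.
    have : (t * e) ^+ 2 <= (t * r%:R) ^+ 2.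
      rewrite ler_pXn2r ?nnegrE ?mulr_ge0 // ler_wpM2l //.
      by rewrite lerBlDr ler_wpDr // ler_nat hD.
    by rewrite /e; lra.
  apply: le_trans (ler_sum _ (fun a _ => le1 a)) _.
  rewrite -mulr_sumr ler_wpM2l ?expR_ge0 //.
  rewrite big_split [in leLHS]big_split /= sumrN sumr_const -!mulr_sumr.
  have -> : (1 + (t * r%:R) ^+ 2) *+ #|T| = #|T|%:R * (1 + (t * r%:R) ^+ 2).
    by rewrite mulr_natl.
  rewrite /Q lerD2l ler_wpM2l // -natr_sum -natrM ler_nat.
  by rewrite (leq_trans (sum_card_setI_le U hD')) // leq_mul2l UB orbT.
elim=> [|k IHk] U UB.
  rewrite (big_pred1 [tuple]) /=; last by move=> a /=; rewrite tuple0; apply/esym/eqP.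
  by rewrite /hit big_nil finset.setU0 mulr1.
(* [Q] contains a negative term, but [step] at the empty set bounds a sum of exponentials by it. *)
have Q0 : 0 <= Q.
  have := step finset.set0; rewrite cards0 mulr0 oppr0 expR0 mul1r => /(_ isT).
  by apply: le_trans; apply: sumr_ge0 => a _; exact: expR_ge0.
rewrite sum_tuple_cons.
have le2 a : \sum_(s : k.-tuple T)
    expR (- (t * #|(U :|: hit D (cons_tuple a s))%SET|%:R)) <=
    expR (- (t * #|(U :|: D a)%SET|%:R)) * Q ^+ k.
  under eq_bigr do rewrite hit_cons finset.setUA.
  apply: IHk; rewrite (leq_trans _ UB) // mulnS addnA leq_add2r.
  by rewrite (leq_trans (leq_card_setU _ _)) // leq_add2l.
apply: le_trans (ler_sum _ (fun a _ => le2 a)) _.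
rewrite -mulr_suml exprS mulrA ler_wpM2r ?exprn_ge0 //.
by apply: step; rewrite (leq_trans _ UB) // leq_addr.
Qed.

(** The probability that no entry of a uniform tuple [b] falls in the union selected by an
    independent uniform tuple [a]. The family [D] is abstract so that the same bounds serve a single
    group element and a pair of elements. *)
Definition avoid (R : realType) {T : finType} (D : T -> {set T}) (k : nat) : R :=
  (\sum_(ab : k.-tuple T * k.-tuple T)
    (all (fun b => b \notin hit D ab.1) ab.2)%:R) / #|T|%:R ^+ (2 * k).

(** Given [a], the entries of [b] are independent and each avoids the union with the same
    probability, so [b] can be summed out. *)
Lemma avoidE {R : realType} {T : finType} {D : T -> {set T}} {k : nat} :
  (0 < #|T|)%N ->
  avoid R D k = (\sum_(a : k.-tuple T) (1 - #|hit D a|%:R / #|T|%:R) ^+ k) / #|T|%:R ^+ k.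
Proof.
move=> T0; have nT0 : #|T|%:R != 0 :> R by rewrite pnatr_eq0 -lt0n.
rewrite /avoid -(pair_bigA _ (fun a b : k.-tuple T => (all (fun b => b \notin hit D a) b)%:R)) /=.
rewrite mul2n -addnn exprD invfM mulrA; congr (_ / _).
rewrite mulr_suml; apply: eq_bigr => a _.
have -> : \sum_(b : k.-tuple T) (all (fun b => b \notin hit D a) b)%:R =
    \sum_(b : k.-tuple T) \prod_(x <- b) ((x \notin hit D a)%:R : R).
  by apply: eq_bigr => b _; elim: (tval b) => [|x s IHs];
    rewrite ?big_nil ?big_cons //= -IHs -natrM mulnb.
rewrite sum_tuple_prod -expr_div_n; congr (_ ^+ k).
rewrite -[X in _ = X - _](mulfV nT0) -mulrBl; congr (_ / _).
rewrite -natr_sum -natrB ?max_card //; congr (_%:R).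
rewrite -(cardsC (hit D a)) addKn -sum1_card [RHS]big_mkcond.
by apply: eq_bigr => x _; rewrite inE; case: (x \in hit D a).
Qed.

Lemma avoid_le {R : realType} {T : finType} {D : T -> {set T}} {k : nat} (r : nat) :
  let n : R := #|T|%:R in
  (0 < #|T|)%N -> (forall a, #|D a| <= r)%N ->
  (forall u, #|[set a | u \in D a]%SET| <= r)%N ->
  avoid R D k <= expR (- (k%:R ^+ 2 / n * ((\sum_a #|D a|%:R) / n))
                       + 2 * r%:R ^+ 2 * (k%:R ^+ 3 / n ^+ 2)).
Proof.
move=> n T0 hD hD'; have n0 : 0 < n by rewrite ltr0n.
have nz : n != 0 by rewrite gt_eqF.
pose t := k%:R / n; have t0 : 0 <= t by rewrite divr_ge0.
rewrite avoidE // ler_pdivrMr ?exprn_gt0 //.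
have le1 (a : k.-tuple T) :
    (1 - #|hit D a|%:R / n) ^+ k <= expR (- (t * #|(finset.set0 :|: hit D a)%SET|%:R)).
  rewrite finset.set0U.
  have -> : - (t * #|hit D a|%:R) = (- (#|hit D a|%:R / n)) * k%:R by rewrite /t; field.
  rewrite expRM_natr lerXn2r ?nnegrE ?expR_ge0 ?expR_ge1Dx //.
  by rewrite subr_ge0 ler_pdivrMr // mul1r ler_nat max_card.
apply: le_trans (ler_sum _ (fun a _ => le1 a)) _.
apply: le_trans (occupancy_le (r * k) t0 hD hD' k _ _) _; first by rewrite cards0.
rewrite cards0 mulr0 oppr0 expR0 mul1r.
set d := \sum_a _; set Q := (X in X ^+ k <= _).
have -> : expR (- (k%:R ^+ 2 / n * (d / n)) + 2 * r%:R ^+ 2 * (k%:R ^+ 3 / n ^+ 2)) * n ^+ k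
    = (expR (- (t * (d / n)) + 2 * r%:R ^+ 2 * t ^+ 2) * n) ^+ k.
  rewrite exprMn -expRM_natr; congr (expR _ * _).
  by rewrite /t; field.
(* The error [2 * r ^ 2 * t ^ 2] has two equal halves: the quadratic term of the exponential, and
   the overlap with the at most [r * k] points already hit, since [t = k / n]. *)
have QE : Q = (1 + (- (t * (d / n)) + 2 * r%:R ^+ 2 * t ^+ 2)) * n.
  by rewrite /Q natrM /t -/n; field.
have dle : d <= n * r%:R.
  rewrite /d -natr_sum -natrM ler_nat -sum_nat_const.
  by apply: leq_sum => a _.
(* No smallness of [k / n] is available here; with [s = t * r] the bound needed is
   [1 - s + 2 * s ^ 2 >= 0], true for every real [s]. *)
have Q0 : 0 <= Q.
  rewrite QE mulr_ge0 //.
  have : t * (d / n) <= t * r%:R by rewrite ler_wpM2l // ler_pdivrMr // mulrC.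
  have : 0 <= (2 * (t * r%:R) - 1) ^+ 2 by exact: sqr_ge0.
  by nra.
rewrite lerXn2r ?nnegrE ?mulr_ge0 ?expR_ge0 ?(ltW n0) //.
by rewrite QE ler_wpM2r ?(ltW n0) // expR_ge1Dx.
Qed.

(** For a lower bound overlaps only help: the size of the union is at most the sum of the sizes, and
    the estimate factors over the entries of [a]. [expRN_ge] is used twice, for the entries of [b]
    and for the mean over one entry of [a]. Each use costs [2 * (t * r) ^ 2 * k] in the exponent,
    whence the 4. *)
Lemma avoid_ge {R : realType} {T : finType} {D : T -> {set T}} {k : nat} (r : nat) :
  let n : R := #|T|%:R in
  (0 < #|T|)%N -> (forall a, #|D a| <= r)%N ->
  r%:R * k%:R / n <= 2^-1 ->
  expR (- (k%:R ^+ 2 / n * ((\sum_a #|D a|%:R) / n))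
        - 4 * r%:R ^+ 2 * (k%:R ^+ 3 / n ^+ 2)) <= avoid R D k.
Proof.
move=> n T0 hD small; have n0 : 0 < n by rewrite ltr0n.
have nz : n != 0 by rewrite gt_eqF.
pose t := k%:R / n; have t0 : 0 <= t by rewrite divr_ge0.
have rt2 : t * r%:R <= 2^-1 by rewrite /t mulrAC [k%:R * _]mulrC.
have rt0 : 0 <= t * r%:R by rewrite mulr_ge0.
rewrite avoidE // ler_pdivlMr ?exprn_gt0 //.
have hitr (a : k.-tuple T) : #|hit D a|%:R <= r%:R * k%:R :> R.
  rewrite -natrM ler_nat (leq_trans (card_hit_le _ _)) //.
  rewrite big_tuple (leq_trans (leq_sum _ (fun i _ => hD _))) //.
  by rewrite sum_nat_const card_ord mulnC.
have le1 (a : k.-tuple T) : expR (- (2 * (t * r%:R) ^+ 2 * k%:R)) *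
    \prod_(x <- a) expR (- (t * #|D x|%:R)) <= (1 - #|hit D a|%:R / n) ^+ k.
  have h0 : 0 <= #|hit D a|%:R / n by rewrite divr_ge0 // ltW.
  have hle : #|hit D a|%:R / n <= t * r%:R.
    by rewrite /t mulrAC [k%:R * _]mulrC ler_wpM2r ?invr_ge0 ?(ltW n0).
  have := @expRN_ge _ (#|hit D a|%:R / n); rewrite h0 (le_trans hle rt2) => /(_ isT) e1.
  have : expR (- (#|hit D a|%:R / n) - 2 * (#|hit D a|%:R / n) ^+ 2) ^+ k
      <= (1 - #|hit D a|%:R / n) ^+ k.
    by rewrite lerXn2r ?nnegrE ?expR_ge0 // (le_trans (expR_ge0 _) e1).
  apply: le_trans.
  rewrite -expRM_natr -expR_sum -expRD ler_expR.
  have -> : \sum_(x <- a) - (t * #|D x|%:R) = - (t * (\sum_(x <- a) #|D x|)%:R) :> R.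
    by rewrite natr_sum mulr_sumr sumrN.
  have : #|hit D a|%:R <= (\sum_(x <- a) #|D x|)%:R :> R by rewrite ler_nat card_hit_le.
  move=> /(ler_wpM2l t0) i1.
  have i2 : (#|hit D a|%:R / n) ^+ 2 <= (t * r%:R) ^+ 2 by rewrite lerXn2r ?nnegrE.
  have {}i2 := ler_wpM2r (ler0n R k) i2.
  have e2 : (- (#|hit D a|%:R / n) - 2 * (#|hit D a|%:R / n) ^+ 2) * k%:R =
    - (t * #|hit D a|%:R) - 2 * ((#|hit D a|%:R / n) ^+ 2 * k%:R).
    by rewrite /t; field.
  by rewrite e2; lra.
apply: le_trans (ler_sum _ (fun a _ => le1 a)).
rewrite -mulr_sumr sum_tuple_prod.
set d := \sum_a _.
have d0 : 0 <= d / n by rewrite divr_ge0 ?(ltW n0) // sumr_ge0.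
have dle : t * (d / n) <= t * r%:R.
  rewrite ler_wpM2l // ler_pdivrMr // mulrC /d -natr_sum -natrM ler_nat -sum_nat_const.
  by apply: leq_sum => a _.
have le2 : n * (1 - t * (d / n)) <= \sum_a expR (- (t * #|D a|%:R)).
  have -> : n * (1 - t * (d / n)) = \sum_a (1 - t * #|D a|%:R).
    by rewrite big_split /= sumr_const sumrN -mulr_sumr -/d -/n; field.
  by apply: ler_sum => a _; exact: expR_ge1Dx.
have le3 : n * expR (- (t * (d / n)) - 2 * (t * r%:R) ^+ 2) <=
    \sum_a expR (- (t * #|D a|%:R)).
  apply: le_trans le2; rewrite ler_wpM2l ?(ltW n0) //.
  have td0 : 0 <= t * (d / n) by rewrite mulr_ge0.
  apply: le_trans (expRN_ge _); last by rewrite td0 (le_trans dle).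
  rewrite ler_expR lerD2l lerN2 ler_wpM2l // lerXn2r ?nnegrE //.
have : (n * expR (- (t * (d / n)) - 2 * (t * r%:R) ^+ 2)) ^+ k <=
    (\sum_a expR (- (t * #|D a|%:R))) ^+ k.
  by rewrite lerXn2r ?nnegrE ?mulr_ge0 ?expR_ge0 ?(ltW n0) // sumr_ge0 // => a _; exact: expR_ge0.
move=> /(ler_wpM2l (expR_ge0 (- (2 * (t * r%:R) ^+ 2 * k%:R)))).
apply: le_trans; rewrite [(n * _) ^+ k]exprMn -expRM_natr [leRHS]mulrCA -expRD [leLHS]mulrC.
rewrite ler_wpM2l ?exprn_ge0 ?(ltW n0) // ler_expR le_eqVlt; apply/orP; left.
by apply/eqP; rewrite /t; field.
Qed.

(** * Factorizations of a group element *)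

Lemma card_finGroup_gt0 (gT : finGroupType) : (0 < #|gT|)%N.
Proof. by apply/card_gt0P; exists (1%g : gT). Qed.

(** The solutions [u] of [a * u = x] or [u * a = x]: exactly the entries of [b] that, together with
    [a], produce [x]. *)
Definition factors {gT : finGroupType} (x a : gT) : {set gT} :=
  [set (a^-1 * x)%g; (x * a^-1)%g]%SET.

(** The two solutions coincide exactly when [a] commutes with [x]; this is how centralizers
    enter. *)
Lemma card_factors {gT : finGroupType} (x a : gT) :
  #|factors x a| = (a \notin 'C[x]%g).+1.
Proof.
rewrite /factors cards2; congr (nat_of_bool (~~ _)).+1.
by rewrite -groupV cent1E eq_sym.
Qed.

Lemma card_factors_le {gT : finGroupType} (x a : gT) : (#|factors x a| <= 2)%N.
Proof. by rewrite card_factors; case: (a \notin _). Qed.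

Lemma card_mem_factors_le {gT : finGroupType} (x u : gT) :
  (#|[set a | u \in factors x a]%SET| <= 2)%N.
Proof.
apply: (@leq_trans #|[set (x * u^-1)%g; (u^-1 * x)%g]%SET|); last by rewrite cards2; case: eqP.
apply/subset_leq_card/fintype.subsetP => a; rewrite !inE.
by case/orP=> /eqP ->; rewrite !invMg !invgK ?mulKVg ?mulgKV eqxx ?orbT.
Qed.

Lemma coversE {gT : finGroupType} {k : nat} (a b : k.-tuple gT) :
  covers a b = [forall x, ~~ all (fun u => u \notin hit (factors x) a) b].
Proof.
have memE x : (x \in [set (x * y)%g | x in [set x in a], y in [set x in b]]
      :|: [set (y * x)%g | x in [set x in a], y in [set x in b]])%SET
    = ~~ all (fun u => u \notin hit (factors x) a) b.
  rewrite -has_predC inE; apply/idP/idP.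
    case/orP=> /imset2P[u v]; rewrite !inE => ua vb ->; apply/hasP; exists v => //=;
      rewrite negbK mem_hit; apply/hasP; exists u => //; rewrite !inE.
      by rewrite mulKg eqxx.
    by rewrite mulgK eqxx orbT.
  case/hasP=> v vb /=; rewrite negbK mem_hit => /hasP[u ua]; rewrite !inE => /orP[]/eqP vE.
    by apply/orP; left; apply/imset2P; exists u v; rewrite ?inE // vE mulKVg.
  by apply/orP; right; apply/imset2P; exists u v; rewrite ?inE // vE mulgKV.
rewrite /covers; apply/eqP/forallP => [h x|h].
  by rewrite -memE h inE.
by apply/setP => x; rewrite memE h inE.
Qed.

(** * First and second moments of the number of missed elements *)

Definition missed {gT : finGroupType} {k : nat} (x : gT) (ab : k.-tuple gT * k.-tuple gT) :=
  all (fun u => u \notin hit (factors x) ab.1) ab.2.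

Lemma PcovE {R : realType} {gT : finGroupType} {k : nat} :
  Pcov R gT k = (\sum_(ab : k.-tuple gT * k.-tuple gT) (covers ab.1 ab.2)%:R)
    / #|gT|%:R ^+ (2 * k).
Proof.
rewrite /Pcov natrX; congr (_ / _); rewrite -sum1_card natr_sum big_mkcond /=.
apply: eq_bigr => ab _.
(* The set inside [Pcov] is a classical set, so its membership has to be converted back to the
   boolean [covers]. *)
by case: ifPn => [/set_mem /= ->//|/negP h]; case: (boolP (covers _ _)) => // /mem_set.
Qed.

Lemma sum_pair_tuple_const {R : realType} {T : finType} (k : nat) (c : R) :
  \sum_(ab : k.-tuple T * k.-tuple T) c = c * #|T|%:R ^+ (2 * k).
Proof.
by rewrite sumr_const card_prod !card_tuple -expnD addnn -mul2n -natrX mulr_natr.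
Qed.

Lemma Pcov_union {R : realType} {gT : finGroupType} (k : nat) :
  1 - Pcov R gT k <= \sum_(x : gT) avoid R (factors x) k.
Proof.
have nk : 0 < #|gT|%:R ^+ (2 * k) :> R by rewrite exprn_gt0 // ltr0n (card_finGroup_gt0 gT).
rewrite PcovE -mulr_suml ler_pdivlMr // mulrBl mul1r divfK ?gt_eqF //.
rewrite -[X in X - _]mul1r -sum_pair_tuple_const -sumrB exchange_big /=.
apply: ler_sum => ab _; rewrite coversE; case: (boolP [forall x, _]) => [_|].
  by rewrite subrr sumr_ge0.
rewrite negb_forall subr0 => /existsP[x]; rewrite negbK => hx.
by rewrite (bigD1 x) //= hx lerDl sumr_ge0.
Qed.

Lemma sum_natM_avoid {R : realType} {gT : finGroupType} {k : nat} (x y : gT) :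
  (\sum_(ab : k.-tuple gT * k.-tuple gT) (missed x ab)%:R * (missed y ab)%:R)
    / #|gT|%:R ^+ (2 * k) = avoid R (fun a => factors x a :|: factors y a)%SET k.
Proof.
rewrite /avoid; congr (_ / _); apply: eq_bigr => ab _; rewrite -natrM mulnb /missed.
congr (nat_of_bool _)%:R; rewrite -all_predI; apply: eq_all => u /=.
rewrite !mem_hit -negb_or -has_predU; congr (~~ _); apply: eq_has => a /=.
by rewrite [RHS]finset.in_setU.
Qed.

(** Chebyshev's inequality cleared of denominators: where [covers] holds, the number [N] of missed
    elements is 0 and [(N - mu) ^+ 2] equals [mu ^+ 2], so the covering probability times [mu ^+ 2]
    is at most the variance. *)
Lemma Pcov_second_moment {R : realType} {gT : finGroupType} (k : nat) :
  Pcov R gT k * (\sum_(x : gT) avoid R (factors x) k) ^+ 2 <=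
  \sum_(x : gT) \sum_(y : gT) avoid R (fun a => factors x a :|: factors y a)%SET k
  - (\sum_(x : gT) avoid R (factors x) k) ^+ 2.
Proof.
set mu := \sum_x avoid R (factors x) k.
have nk : 0 < #|gT|%:R ^+ (2 * k) :> R by rewrite exprn_gt0 // ltr0n (card_finGroup_gt0 gT).
pose N (ab : k.-tuple gT * k.-tuple gT) : R := \sum_x (missed x ab)%:R.
have muE : \sum_ab N ab = mu * #|gT|%:R ^+ (2 * k).
  by rewrite /mu -mulr_suml divfK ?gt_eqF // exchange_big.
have m2E : \sum_ab N ab ^+ 2 =
    (\sum_(x : gT) \sum_(y : gT) avoid R (fun a => factors x a :|: factors y a)%SET k)
    * #|gT|%:R ^+ (2 * k).
  rewrite mulr_suml; under [RHS]eq_bigr => x _ do rewrite mulr_suml.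
  under [RHS]eq_bigr => x _ do under eq_bigr => y _ do
    rewrite -sum_natM_avoid divfK ?gt_eqF //.
  under [LHS]eq_bigr => ab _ do rewrite expr2 mulr_suml.
  rewrite exchange_big; apply: eq_bigr => x _; rewrite [RHS]exchange_big.
  by apply: eq_bigr => ab _; rewrite mulr_sumr.
have : \sum_(ab : k.-tuple gT * k.-tuple gT) (covers ab.1 ab.2)%:R * mu ^+ 2 <=
    \sum_ab (N ab - mu) ^+ 2.
  apply: ler_sum => ab _; case: (boolP (covers _ _)) => [|_]; last by rewrite mul0r sqr_ge0.
  rewrite coversE => /forallP hc; rewrite /N big1 ?sub0r ?sqrrN ?mul1r // => x _.
  by rewrite /missed (negbTE (hc x)).
have -> : \sum_ab (N ab - mu) ^+ 2 = \sum_ab N ab ^+ 2 - mu ^+ 2 * #|gT|%:R ^+ (2 * k).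
  under eq_bigr do rewrite sqrrB -mulrnAr.
  rewrite big_split sumrB /= sum_pair_tuple_const.
  by rewrite -mulr_suml muE; ring.
rewrite -mulr_suml m2E -mulrBl -ler_pdivrMr //.
by apply: le_trans; rewrite PcovE mulrAC.
Qed.

(** * Mean sizes of the factor sets and the resulting probabilities *)

Lemma mean_card_factors {R : realType} {gT : finGroupType} (x : gT) :
  (\sum_a #|factors x a|%:R) / #|gT|%:R = 2 - #|'C[x]%g|%:R / #|gT|%:R :> R.
Proof.
have n0 : #|gT|%:R != 0 :> R by rewrite pnatr_eq0 -lt0n (card_finGroup_gt0 gT).
have -> : \sum_a #|factors x a|%:R = 2 * #|gT|%:R - #|'C[x]%g|%:R :> R.
  have -> : #|'C[x]%g|%:R = \sum_a (a \in 'C[x]%g)%:R :> R.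
    by rewrite -sum1_card natr_sum big_mkcond; apply: eq_bigr => a _; case: ifP.
  have -> : 2 * #|gT|%:R = \sum_(a : gT) 2 :> R by rewrite sumr_const mulr_natr.
  rewrite -sumrB; apply: eq_bigr => a _; rewrite card_factors.
  by case: (a \in _); rewrite ?subr0 //=; lra.
by rewrite mulrBl mulfK.
Qed.

(* For [x <> y], the two pairs of factors overlap at [a] only if [a]
   conjugates [x] to [y] or [y] to [x]. *)
Lemma mean_card_factorsU {R : realType} {gT : finGroupType} {x y : gT} :
  x != y ->
  4 - #|'C[x]%g|%:R / #|gT|%:R - #|'C[y]%g|%:R / #|gT|%:R
    - 2 * (#|[set a | (x ^ a)%g == y]%SET|%:R / #|gT|%:R) <=
  (\sum_a #|(factors x a :|: factors y a)%SET|%:R) / #|gT|%:R :> R.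
Proof.
move=> xy; have n0 : 0 < #|gT|%:R :> R by rewrite ltr0n (card_finGroup_gt0 gT).
have cI (a : gT) : (#|factors x a :&: factors y a|%SET <= ((x ^ a)%g == y) + ((y ^ a)%g == x))%N.
  have eqs : (factors x a :&: factors y a \subset
      (if ((x ^ a)%g == y) then [set (a^-1 * x)%g] else finset.set0) :|:
      (if ((y ^ a)%g == x) then [set (a^-1 * y)%g] else finset.set0))%SET.
    apply/fintype.subsetP => u; rewrite !inE => /andP[/orP[]/eqP -> /orP[]/eqP e].
    - by case/eqP: xy; apply: mulgI e.
    - have -> : (x ^ a)%g = y by rewrite conjgE mulgA e mulgKV.
      by rewrite eqxx !inE e eqxx.
    - have -> : (y ^ a)%g = x by rewrite conjgE mulgA -e mulgKV.
      by rewrite eqxx !inE e eqxx orbT.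
    - by case/eqP: xy; apply: mulIg e.
  apply: leq_trans (subset_leq_card eqs) _.
  apply: leq_trans (leq_card_setU _ _) _.
  by apply: leq_add; case: ifP => _; rewrite ?cards1 ?cards0.
have sumI (z w : gT) : \sum_a ((z ^ a)%g == w)%:R = #|[set a | (z ^ a)%g == w]%SET|%:R :> R.
  by rewrite -sum1dep_card natr_sum [RHS]big_mkcond; apply: eq_bigr => a _; case: ifP.
(* Inversion matches the elements conjugating [y] to [x] with those conjugating [x] to [y], hence
   the factor 2 in the statement. *)
have cV : #|[set a | (y ^ a)%g == x]%SET| = #|[set a | (x ^ a)%g == y]%SET|.
  rewrite -(card_imset _ (@invg_inj gT)); congr #|pred_of_set _|; apply/setP => a.
  rewrite -[a]invgK mem_imset; last exact: invg_inj.
  by rewrite !inE invgK; apply/eqP/eqP => <-; rewrite ?conjgK ?conjgKV.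
have sU : \sum_a #|(factors x a :|: factors y a)%SET|%:R +
    \sum_a #|(factors x a :&: factors y a)%SET|%:R =
    \sum_a #|factors x a|%:R + \sum_a #|factors y a|%:R :> R.
  by rewrite -!big_split; apply: eq_bigr => a _ /=; rewrite -!natrD cardsUI.
have sI : \sum_a #|(factors x a :&: factors y a)%SET|%:R <=
    2 * #|[set a | (x ^ a)%g == y]%SET|%:R :> R.
  have -> : 2 * #|[set a | (x ^ a)%g == y]%SET|%:R =
      \sum_a (((x ^ a)%g == y)%:R + ((y ^ a)%g == x)%:R) :> R.
    by rewrite big_split /= !sumI cV; ring.
  by apply: ler_sum => a _; rewrite -natrD ler_nat.
have nz : #|gT|%:R != 0 :> R by rewrite gt_eqF.
have ex := canRL (divfK nz) (mean_card_factors (R := R) x).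
have ey := canRL (divfK nz) (mean_card_factors (R := R) y).
rewrite ler_pdivlMr //.
have : (4 - #|'C[x]%g|%:R / #|gT|%:R - #|'C[y]%g|%:R / #|gT|%:R
    - 2 * (#|[set a | (x ^ a)%g == y]%SET|%:R / #|gT|%:R)) * #|gT|%:R =
    (2 - #|'C[x]%g|%:R / #|gT|%:R) * #|gT|%:R + (2 - #|'C[y]%g|%:R / #|gT|%:R) * #|gT|%:R
    - 2 * #|[set a | (x ^ a)%g == y]%SET|%:R :> R.
  by field.
by move=> ->; rewrite -ex -ey; lra.
Qed.

(** The error constants here and in the next two lemmas come from the general bounds:
    [8 = 2 * 2 ^ 2], [16 = 4 * 2 ^ 2], and [32 = 2 * 4 ^ 2] for the union of two factor sets. *)
Lemma avoid_factors_le {R : realType} {gT : finGroupType} (x : gT) (k : nat) :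
  avoid R (factors x) k <=
  expR (- (k%:R ^+ 2 / #|gT|%:R * (2 - #|'C[x]%g|%:R / #|gT|%:R))
        + 8 * (k%:R ^+ 3 / #|gT|%:R ^+ 2)).
Proof.
have := avoid_le (R := R) (D := factors x) (k := k) 2 (card_finGroup_gt0 gT)
  (card_factors_le x) (card_mem_factors_le x).
by rewrite mean_card_factors => /le_trans -> //; rewrite ler_expR lerD2l; lra.
Qed.

Lemma avoid_factors_ge {R : realType} {gT : finGroupType} (x : gT) (k : nat) :
  let n : R := #|gT|%:R in
  2 * k%:R / n <= 2^-1 ->
  expR (- (k%:R ^+ 2 / n * (2 - #|'C[x]%g|%:R / n)) - 16 * (k%:R ^+ 3 / n ^+ 2)) <=
  avoid R (factors x) k.
Proof.
move=> n small; have := avoid_ge (R := R) (D := factors x) (k := k) 2 (card_finGroup_gt0 gT)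
  (card_factors_le x) small.
by rewrite mean_card_factors; apply: le_trans; rewrite ler_expR lerD2l; lra.
Qed.

Lemma avoid_factorsU_le {R : realType} {gT : finGroupType} (x y : gT) (k : nat) :
  let n : R := #|gT|%:R in
  x != y ->
  avoid R (fun a => factors x a :|: factors y a)%SET k <=
  expR (- (k%:R ^+ 2 / n * (2 - #|'C[x]%g|%:R / n)))
  * expR (- (k%:R ^+ 2 / n * (2 - #|'C[y]%g|%:R / n)))
  * expR (2 * (k%:R ^+ 2 / n) * (#|[set a | (x ^ a)%g == y]%SET|%:R / n)
          + 32 * (k%:R ^+ 3 / n ^+ 2)).
Proof.
move=> n xy.
have c4 a : (#|factors x a :|: factors y a|%SET <= 4)%N.
  by rewrite (leq_trans (leq_card_setU _ _)) // (leq_add (card_factors_le x a) (card_factors_le y a)).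
have m4 u : (#|[set a | u \in factors x a :|: factors y a]%SET| <= 4)%N.
  have -> : ([set a | u \in factors x a :|: factors y a] =
      [set a | u \in factors x a] :|: [set a | u \in factors y a])%SET.
    by apply/setP => a; rewrite !finset.in_set.
  rewrite (leq_trans (leq_card_setU _ _)) //.
  exact: (leq_add (card_mem_factors_le x u) (card_mem_factors_le y u)).
apply: le_trans (avoid_le (R := R) (k := k) 4 (card_finGroup_gt0 gT) c4 m4) _.
rewrite -!expRD ler_expR.
have L0 : 0 <= k%:R ^+ 2 / n by rewrite divr_ge0 // exprn_ge0.
have := ler_wpM2l L0 (mean_card_factorsU (R := R) xy); rewrite -/n.
set E := k%:R ^+ 3 / _; set L := k%:R ^+ 2 / _; set d := (\sum_a _) / n.
set cx := _ / n; set cy := #|'C[y]%g|%:R / n; set q := _ / n.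
by move=> h; lra.
Qed.

(** The trivial bound, meant for the few strongly correlated pairs. *)
Lemma avoid_factorsU_le_avoid {R : realType} {gT : finGroupType} (x y : gT) (k : nat) :
  avoid R (fun a => factors x a :|: factors y a)%SET k <= avoid R (factors x) k.
Proof.
rewrite -sum_natM_avoid /avoid ler_wpM2r ?invr_ge0 ?exprn_ge0 //.
by apply: ler_sum => ab _; rewrite -natrM mulnb ler_nat /missed; case: (all _ _); case: (all _ _).
Qed.

(** * Bounds on the covering probability of a fixed group *)

(* Approximately the mean number of group elements outside [AB :|: BA],
   where [L] stands for [k ^ 2 / n]. *)
Definition expected_missed {R : realType} (gT : finGroupType) (L : R) : R :=
  \sum_(x : gT) expR (- (L * (2 - #|'C[x]%g|%:R / #|gT|%:R))).

Lemma Pcov_ge {R : realType} {gT : finGroupType} (k : nat) :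
  1 - expected_missed gT (k%:R ^+ 2 / #|gT|%:R)
      * expR (8 * (k%:R ^+ 3 / #|gT|%:R ^+ 2)) <= Pcov R gT k.
Proof.
rewrite lerBlDr -lerBlDl; apply: le_trans (Pcov_union k) _.
by rewrite /expected_missed mulr_suml; apply: ler_sum => x _; rewrite -expRD; exact: avoid_factors_le.
Qed.

(* The pairs [(x, y)] with [n < w * #|{a | x ^ a = y}|] are too correlated;
   since [\sum_y #|{a | x ^ a = y}| = n], each [x] has at most [w] such partners. *)
Lemma Pcov_le {R : realType} {gT : finGroupType} (k : nat) (w : R) :
  0 < w -> 2 * k%:R / #|gT|%:R <= 2^-1 :> R ->
  Pcov R gT k <=
  (w + 1) * expR (16 * (k%:R ^+ 3 / #|gT|%:R ^+ 2))
  / expected_missed gT (k%:R ^+ 2 / #|gT|%:R)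
  + (expR (2 * (k%:R ^+ 2 / #|gT|%:R) / w + 64 * (k%:R ^+ 3 / #|gT|%:R ^+ 2)) - 1).
Proof.
move=> w0 small.
have n0 : 0 < #|gT|%:R :> R by rewrite ltr0n (card_finGroup_gt0 gT).
pose q (x y : gT) : R := #|[set a | (x ^ a)%g == y]%SET|%:R.
have q0 x y : 0 <= q x y by [].
pose e (x : gT) := expR (- (k%:R ^+ 2 / #|gT|%:R * (2 - #|'C[x]%g|%:R / #|gT|%:R))) : R.
have e0 x : 0 < e x by exact: expR_gt0.
have L0 : 0 <= k%:R ^+ 2 / #|gT|%:R :> R by rewrite divr_ge0 // exprn_ge0.
have avge (x : gT) : expR (- (16 * (k%:R ^+ 3 / #|gT|%:R ^+ 2))) * e x <= avoid R (factors x) k.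
  by rewrite /e mulrC -expRD; exact: avoid_factors_ge small.
have avUle (x y : gT) : x != y -> avoid R (fun a => factors x a :|: factors y a)%SET k <=
    e x * e y * expR (2 * (k%:R ^+ 2 / #|gT|%:R) * (q x y / #|gT|%:R)
      + 32 * (k%:R ^+ 3 / #|gT|%:R ^+ 2)).
  by move=> xy; exact: avoid_factorsU_le.
rewrite /expected_missed -/(\sum_x e x).
move: avge avUle L0; set L := k%:R ^+ 2 / _; set E := k%:R ^+ 3 / _ => avge avUle L0.
set S := \sum_x e x; have S0 : 0 < S.
  by rewrite /S (bigD1 1%g) //= ltr_wpDr // sumr_ge0 // => x _; exact: ltW.
pose mu : R := \sum_(x : gT) avoid R (factors x) k.
have muS : expR (- (16 * E)) * S <= mu by rewrite mulr_sumr; apply: ler_sum => x _; exact: avge.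
have mu0 : 0 < mu by apply: lt_le_trans muS; rewrite mulr_gt0 ?expR_gt0.
have sumq x : \sum_y q x y = #|gT|%:R.
  rewrite -natr_sum; congr _%:R; under eq_bigr do rewrite -sum1dep_card big_mkcond.
  rewrite exchange_big /= -sum1_card; apply: eq_bigr => a _.
  by rewrite -big_mkcond (big_pred1 (x ^ a)%g) // => y; rewrite /= eq_sym.
pose bad x y := (x == y) || (#|gT|%:R < q x y * w).
have sumbad x : \sum_y (bad x y)%:R <= w + 1 :> R.
  (* Markov's inequality pointwise: an off-diagonal bad pair has [q x y * w / n > 1], and these
     quantities sum to [w] over [y]. *)
  apply: (@le_trans _ _ (\sum_y (q x y * (w / #|gT|%:R) + (x == y)%:R))).
    apply: ler_sum => y _; rewrite /bad; case: (x == y) => /=.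
      by rewrite lerDr mulr_ge0 // divr_ge0 // ltW.
    rewrite addr0; case: ltP => h; last by rewrite mulr_ge0 // divr_ge0 // ltW.
    by rewrite mulrA ler_pdivlMr // mul1r ltW.
  rewrite big_split /= -mulr_suml sumq mulrC divfK ?gt_eqF // lerD2l.
  rewrite (bigD1 x) //= eqxx big1 ?addr0 // => y; rewrite eq_sym.
  by move/negbTE => ->.
pose F := expR (2 * L / w + 32 * E).
have M2 : \sum_(x : gT) \sum_(y : gT) avoid R (fun a => factors x a :|: factors y a)%SET k
    <= (w + 1) * mu + S ^+ 2 * F.
  apply: (@le_trans _ _ (\sum_x \sum_y (avoid R (factors x) k * (bad x y)%:R + e x * (e y * F)))).
    apply: ler_sum => x _; apply: ler_sum => y _.
    case: (boolP (bad x y)) => [_|]; rewrite /= ?mulr1 ?mulr0 ?add0r.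
      apply: le_trans (avoid_factorsU_le_avoid x y k) _.
      by rewrite lerDl !mulr_ge0 ?expR_ge0 // ltW.
    rewrite negb_or -leNgt => /andP[xy qw].
    apply: le_trans (avUle _ _ xy) _; rewrite [leRHS]mulrA ler_wpM2l ?mulr_ge0 ?(ltW (e0 _)) //.
    rewrite ler_expR lerD2r; apply: ler_wpM2l; first by apply: mulr_ge0.
    by rewrite ler_pdivrMr // mulrC ler_pdivlMr.
  have -> : S ^+ 2 * F = \sum_x e x * (S * F) by rewrite -mulr_suml expr2 mulrA.
  rewrite mulr_sumr -big_split /=; apply: ler_sum => x _.
  rewrite big_split /= -!mulr_sumr -mulr_suml lerD2r mulrC ler_wpM2r //.
  by apply: le_trans (avge x); rewrite mulr_ge0 ?expR_ge0 // ltW.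
have := le_trans (Pcov_second_moment (R := R) (gT := gT) k) (lerB M2 (lexx _)).
rewrite -/mu => main.
(* This allows division by [mu ^+ 2]: the diagonal and correlated pairs pay the factor
   [expR (16 * E)] once, the remaining pairs pay it squared, which turns [32 * E] into [64 * E]. *)
have SE : S <= expR (16 * E) * mu.
  by rewrite -(ler_pM2l (expR_gt0 (- (16 * E)))) [leRHS]mulrA -expRD addNr expR0 mul1r.
have S2 : S ^+ 2 * F <= mu ^+ 2 * expR (2 * L / w + 64 * E).
  have -> : mu ^+ 2 * expR (2 * L / w + 64 * E) = (expR (16 * E) * mu) ^+ 2 * F.
    rewrite exprMn -expRM_natr /F [RHS]mulrAC -expRD [RHS]mulrC; congr (_ * expR _).
    by ring.
  rewrite ler_wpM2r ?expR_ge0 // lerXn2r ?nnegrE ?(ltW S0) //.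
  by rewrite mulr_ge0 ?expR_ge0 // ltW.
have mu20 : 0 < mu ^+ 2 by rewrite exprn_gt0.
have t1 : (w + 1) * mu <= (w + 1) * expR (16 * E) / S * mu ^+ 2.
  have -> : (w + 1) * expR (16 * E) / S * mu ^+ 2 = (w + 1) * mu * (expR (16 * E) * mu / S).
    by field; rewrite gt_eqF.
  by rewrite ler_peMr ?ler_pdivlMr ?mul1r // mulr_ge0 ?(ltW mu0) // addr_ge0 // ltW.
rewrite -(ler_pM2r mu20); apply: le_trans main _.
by rewrite [leRHS]mulrDl [X in _ <= _ + X]mulrBl mul1r; lra.
Qed.

(** * [Theta] as the threshold for the expected number of missed elements *)

Lemma centralizer_ratio {R : realType} {gT : finGroupType} (x : gT) :
  0 <= (#|'C[x]%g|%:R / #|gT|%:R : R) <= 1.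
Proof.
have n0 : 0 < #|gT|%:R :> R by rewrite ltr0n (card_finGroup_gt0 gT).
by rewrite divr_ge0 //= ler_pdivrMr // mul1r ler_nat max_card.
Qed.

Lemma continuous_expected_missed {R : realType} {gT : finGroupType} (l : R) :
  continuous (fun xi : R => expected_missed gT (xi * l)).
Proof.
apply: continuous_big; first exact: add_continuous.
move=> x _ xi; apply: continuous_comp; last exact: continuous_expR.
apply: cvgN; apply: cvgMl; apply: cvgMl; exact: cvg_id.
Qed.

Lemma sum_expRN_ln_card {R : realType} {gT : finGroupType} :
  \sum_(x : gT) expR (- ln #|gT|%:R) = 1 :> R.
Proof.
have n0 : 0 < #|gT|%:R :> R by rewrite ltr0n (card_finGroup_gt0 gT).
by rewrite sumr_const expRN lnK ?posrE // -[LHS]mulr_natr mulVf ?gt_eqF.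
Qed.

Lemma ln_card_ge0 {R : realType} {gT : finGroupType} : 0 <= ln #|gT|%:R :> R.
Proof. by rewrite ln_ge0 // ler1n (card_finGroup_gt0 gT). Qed.

(** Dividing by [expR (2 * xi * ln n)] and moving it inside the sum turns the defining equation into
    a statement about [expected_missed]. *)
Lemma Theta_eqP {R : realType} {gT : finGroupType} (xi : R) :
  Theta_eq gT xi <-> expected_missed gT (xi * ln #|gT|%:R) = 1.
Proof.
pose E := \sum_(x : gT) expR (xi * ln #|gT|%:R * (#|'C[x]%g|%:R / #|gT|%:R)) : R.
have E0 : 0 < E.
  rewrite /E (bigD1 1%g) //= ltr_wpDr ?expR_gt0 // sumr_ge0 // => x _; exact: expR_ge0.
have -> : expected_missed gT (xi * ln #|gT|%:R) = E / expR (2 * xi * ln #|gT|%:R).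
  rewrite mulr_suml; apply: eq_bigr => x _; rewrite -expRN -expRD.
  by congr expR; ring.
have e0 := expR_gt0 (2 * xi * ln (#|gT|%:R : R)).
split => [|h]; first by rewrite /Theta_eq -/E => ->; rewrite lnK ?posrE // divff ?gt_eqF.
rewrite /Theta_eq -/E -[LHS]expRK; congr ln.
by apply/esym/divr1_eq.
Qed.

(** Existence is the intermediate value theorem: since [0 <= c <= 1], every summand is at most
    [1 / n] at [xi = 1] and at least [1 / n] at [xi = 1/2]. *)
Lemma Theta_spec {R : realType} (gT : finGroupType) :
  (2^-1 <= Theta R gT <= 1) /\
  expected_missed gT (Theta R gT * ln #|gT|%:R) = 1.
Proof.
have half : (2^-1 : R) <= 1 by lra.
have l0 := @ln_card_ge0 R gT.
suff [xi xi12 xiE] : exists2 xi : R, xi \in `[2^-1, 1]%R &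
    expected_missed gT (xi * ln #|gT|%:R) = 1.
  have : [set xi : R | 2^-1 <= xi <= 1 /\ Theta_eq gT xi] (Theta R gT).
    apply: xgetPex; exists xi; split; first by move: xi12; rewrite in_itv.
    exact/Theta_eqP.
  by case=> ? /Theta_eqP.
apply: (IVT half); first exact/continuous_subspaceT/continuous_expected_missed.
rewrite ge_min le_max; apply/andP; split; apply/orP; [right|left].
  rewrite -[leRHS](@sum_expRN_ln_card R gT); apply: ler_sum => x _.
  have /andP[c0 c1] := @centralizer_ratio R _ x.
  by rewrite ler_expR mul1r lerN2 ler_peMr //; lra.
rewrite -[leLHS](@sum_expRN_ln_card R gT); apply: ler_sum => x _.
have /andP[c0 c1] := @centralizer_ratio R _ x.
rewrite ler_expR lerN2 mulrAC ler_piMl //; lra.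
Qed.

(** Termwise comparison with the sum at [Theta * ln n], which is 1. Each term shrinks by at least
    [expR (- (d * Theta * ln n * (2 - c)))], where [Theta >= 1/2] and [2 - c >= 1]. The next lemma
    is the mirror image. *)
Lemma expected_missed_le {R : realType} {gT : finGroupType} {d L : R} :
  0 <= d -> (1 + d) * (Theta R gT * ln #|gT|%:R) <= L ->
  expected_missed gT L <= expR (- (d / 2 * ln #|gT|%:R)).
Proof.
move=> d0 hL; have [/andP[t12 _] tE] := @Theta_spec R gT.
have l0 := @ln_card_ge0 R gT.
rewrite -[leRHS]mul1r -[X in _ <= X * _]tE mulr_suml; apply: ler_sum => x _.
have /andP[c0 c1] := @centralizer_ratio R _ x.
rewrite -expRD ler_expR -opprD lerN2.
move: (#|'C[x]%g|%:R / _) c0 c1 (Theta R gT) (ln _) {tE} t12 hL l0 => c c0 c1 t l t12 hL l0.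
have : (1 + d) * (t * l) * (2 - c) <= L * (2 - c) by rewrite ler_wpM2r //; lra.
have : d * l * (2^-1 * 1) <= d * l * (t * (2 - c)).
  by rewrite ler_wpM2l ?mulr_ge0 // ler_pM //; lra.
by lra.
Qed.

Lemma expected_missed_ge {R : realType} {gT : finGroupType} {d L : R} :
  0 <= d -> L <= (1 - d) * (Theta R gT * ln #|gT|%:R) ->
  expR (d / 2 * ln #|gT|%:R) <= expected_missed gT L.
Proof.
move=> d0 hL; have [/andP[t12 _] tE] := @Theta_spec R gT.
have l0 := @ln_card_ge0 R gT.
rewrite -[leLHS]mul1r -[X in X * _ <= _]tE mulr_suml; apply: ler_sum => x _.
have /andP[c0 c1] := @centralizer_ratio R _ x.
rewrite -expRD ler_expR.
move: (#|'C[x]%g|%:R / _) c0 c1 (Theta R gT) (ln _) {tE} t12 hL l0 => c c0 c1 t l t12 hL l0.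
have : L * (2 - c) <= (1 - d) * (t * l) * (2 - c) by rewrite ler_wpM2r //; lra.
have : d * l * (2^-1 * 1) <= d * l * (t * (2 - c)).
  by rewrite ler_wpM2l ?mulr_ge0 // ler_pM //; lra.
by lra.
Qed.

(** * Asymptotics in the group order *)

Lemma near_ln_ge {R : realType} (K : R) : \forall n \near \oo, K <= ln (n%:R : R).
Proof.
near=> n; rewrite -[K]expRK ler_ln ?posrE ?expR_gt0 //.
  by near: n; exact: nbhs_infty_ger.
by apply: lt_le_trans (expR_gt0 K) _; near: n; exact: nbhs_infty_ger.
Unshelve. all: by end_near. Qed.

(** [expR_ge_pow] with exponent [j + 1] leaves one spare factor [ln n] to absorb the constants. *)
Lemma near_ln_pow_le {R : realType} (j : nat) (C m eta : R) : 0 < m -> 0 < eta ->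
  \forall n \near \oo, C * ln (n%:R : R) ^+ j <= eta * expR (m * ln n%:R).
Proof.
move=> m0 eta0; near=> n.
have l1 : 1 <= ln (n%:R : R) by near: n; exact: near_ln_ge.
have lK : C / (eta * (m / j.+1%:R) ^+ j.+1) <= ln (n%:R : R) by near: n; exact: near_ln_ge.
move: lK l1; move: (ln _) => l lK l1.
have D0 : 0 < eta * (m / j.+1%:R) ^+ j.+1 by rewrite mulr_gt0 // exprn_gt0 // divr_gt0.
have l0 : 0 <= l by lra.
apply: (@le_trans _ _ (eta * (m * l / j.+1%:R) ^+ j.+1)).
  rewrite mulrAC exprMn mulrA [X in _ <= _ * X]exprS mulrA.
  by rewrite ler_wpM2r ?exprn_ge0 // mulrC -ler_pdivrMr.
by rewrite ler_wpM2l ?(ltW eta0) // expR_ge_pow // mulr_ge0 // ltW.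
Unshelve. all: by end_near. Qed.

(** Squaring reduces the two claims to [4 * c * ln n / n] and [c ^ 3 * (ln n) ^ 3 / n] being small.
    Since [k] is quantified after [n], the threshold is uniform in [k]. *)
Lemma near_lt_sqr_le {R : realType} (c eta : R) : 0 <= c -> 0 < eta ->
  \forall n \near \oo, forall k : R, 0 <= k -> k ^+ 2 <= c * (n%:R * ln n%:R) ->
    2 * k / n%:R <= eta /\ k ^+ 3 / n%:R ^+ 2 <= eta.
Proof.
move=> c0 eta0; near=> n => k k0 hk.
have n0 : 0 < n%:R :> R by rewrite ltr0n; near: n; exact: nbhs_infty_gt.
have h1 : 4 * c * ln (n%:R : R) ^+ 1 <= eta ^+ 2 * expR (1 * ln n%:R).
  by near: n; apply: near_ln_pow_le => //; rewrite exprn_gt0.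
have h3 : c ^+ 3 * ln (n%:R : R) ^+ 3 <= eta ^+ 2 * expR (1 * ln n%:R).
  by near: n; apply: near_ln_pow_le => //; rewrite exprn_gt0.
move: h1 h3; rewrite mul1r lnK ?posrE // expr1 => h1 h3.
have nz : (n%:R : R) != 0 by rewrite gt_eqF.
split; rewrite -(@ler_pXn2r _ 2) ?nnegrE ?(ltW eta0) ?mulr_ge0 ?exprn_ge0 ?invr_ge0 ?exprn_ge0 ?(ltW n0) //.
  have -> : (2 * k / n%:R) ^+ 2 = 4 * k ^+ 2 / n%:R ^+ 2 by field.
  rewrite ler_pdivrMr ?exprn_gt0 //.
  apply: (@le_trans _ _ (4 * (c * (n%:R * ln n%:R)))); first by rewrite ler_wpM2l.
  by have := ler_wpM2l (ltW n0) h1; lra.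
have -> : (k ^+ 3 / n%:R ^+ 2) ^+ 2 = (k ^+ 2) ^+ 3 / n%:R ^+ 4 by field.
rewrite ler_pdivrMr ?exprn_gt0 //.
apply: (@le_trans _ _ ((c * (n%:R * ln n%:R)) ^+ 3)).
  by rewrite lerXn2r ?nnegrE ?exprn_ge0 // (le_trans _ hk) // exprn_ge0.
by have := ler_wpM2l (exprn_ge0 3 (ltW n0)) h3; lra.
Unshelve. all: by end_near. Qed.

Lemma Pcov_itv {R : realType} {gT : finGroupType} (k : nat) : 0 <= Pcov R gT k <= 1.
Proof.
rewrite PcovE divr_ge0 ?exprn_ge0 ?sumr_ge0 //=.
rewrite ler_pdivrMr ?exprn_gt0 ?ltr0n ?(card_finGroup_gt0 gT) //.
rewrite -sum_pair_tuple_const; apply: ler_sum => ab _.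
by case: (covers _ _).
Qed.

(** The threshold depends only on the order, uniformly over all groups of that order, so it applies
    along any sequence of groups. *)
Lemma near_Pcov_ge {R : realType} (eps delta : R) : 0 < eps -> 0 < delta ->
  \forall n \near \oo, forall gT : finGroupType, #|gT| = n ->
  1 - delta <= Pcov R gT `|Num.ceil ((1 + eps) *
    Num.sqrt (Theta R gT * #|gT|%:R * ln (#|gT|%:R : R)))|%N.
Proof.
move=> eps0 delta0; near=> n => gT gTn.
have [/andP[t12 t1] _] := @Theta_spec R gT.
have n0 : 0 < #|gT|%:R :> R by rewrite ltr0n (card_finGroup_gt0 gT).
have n1 : 1 <= #|gT|%:R :> R by rewrite ler1n (card_finGroup_gt0 gT).
have l1 : 1 <= ln (#|gT|%:R : R) by rewrite gTn; near: n; exact: near_ln_ge.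
have nl1 : 1 <= #|gT|%:R * ln (#|gT|%:R : R) by rewrite mulr_ege1.
set C := Num.sqrt _.
have C0 : 0 <= C by exact: sqrtr_ge0.
have C2 : C ^+ 2 = Theta R gT * #|gT|%:R * ln #|gT|%:R.
  by rewrite sqr_sqrtr // !mulr_ge0 ?(ltW n0) //; lra.
have C2n : C ^+ 2 <= #|gT|%:R * ln #|gT|%:R.
  by rewrite C2 -mulrA ler_piMl // (le_trans _ nl1).
set k := `|_|%N.
have kE : k%:R = (Num.ceil ((1 + eps) * C))%:~R :> R.
  by rewrite natr_absz ger0_norm // ceil_ge0 (lt_le_trans (ltrN10 R)) // mulr_ge0 //; lra.
have kge : (1 + eps) * C <= k%:R by rewrite kE ceil_ge.
have kle : k%:R <= (1 + eps) * C + 1.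
  by have /andP[+ _] := ceil_itv ((1 + eps) * C); rewrite kE rmorphB /=; lra.
(* From [(u + 1) ^ 2 <= 2 * u ^ 2 + 2], the last constant being absorbed by [1 <= n * ln n]. *)
have k2le : (k%:R : R) ^+ 2 <= 2 * ((1 + eps) ^+ 2 + 1) * (#|gT|%:R * ln #|gT|%:R).
  have : (k%:R : R) ^+ 2 <= ((1 + eps) * C + 1) ^+ 2 by rewrite lerXn2r ?nnegrE // (le_trans _ kle).
  have : 0 <= ((1 + eps) * C - 1) ^+ 2 by exact: sqr_ge0.
  have : (1 + eps) ^+ 2 * C ^+ 2 <= (1 + eps) ^+ 2 * (#|gT|%:R * ln #|gT|%:R).
    by rewrite ler_wpM2l // sqr_ge0.
  by rewrite -exprMn; move: ((1 + eps) * C) => u; lra.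
have [_ small] : (2 * k%:R / #|gT|%:R <= 1 :> R) /\ k%:R ^+ 3 / #|gT|%:R ^+ 2 <= 1 :> R.
  rewrite gTn; rewrite gTn in k2le.
  move: (k%:R : R) (ler0n R k) k2le; near: n; apply: near_lt_sqr_le => //.
  by rewrite mulr_ge0 // addr_ge0 // sqr_ge0.
apply: le_trans (Pcov_ge k); rewrite lerB //.
have L_ge : (1 + 2 * eps) * (Theta R gT * ln #|gT|%:R) <= k%:R ^+ 2 / #|gT|%:R.
  rewrite ler_pdivlMr //.
  have : ((1 + eps) * C) ^+ 2 <= k%:R ^+ 2.
    by rewrite lerXn2r ?nnegrE ?mulr_ge0 //; lra.
  have : 0 <= eps ^+ 2 * C ^+ 2 by rewrite mulr_ge0 // sqr_ge0.
  by rewrite exprMn C2; lra.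
have d0 : 0 <= 2 * eps by lra.
have e8 : expR (8 * (k%:R ^+ 3 / #|gT|%:R ^+ 2)) <= expR 8 :> R by rewrite ler_expR ler_piMr.
apply: le_trans (ler_pM _ (expR_ge0 _) (expected_missed_le d0 L_ge) e8) _.
  by apply: sumr_ge0 => x _; exact: expR_ge0.
have -> : 2 * eps / 2 = eps by lra.
have : expR 8 * ln (#|gT|%:R : R) ^+ 0 <= delta * expR (eps * ln #|gT|%:R).
  by rewrite gTn; near: n; exact: near_ln_pow_le.
by rewrite expr0 [X in X <= _ -> _]mulr1 [X in _ -> X <= _]mulrC expRN ler_pdivrMr ?expR_gt0.
Unshelve. all: by end_near. Qed.

Lemma near_Pcov_le {R : realType} (eps delta : R) : 0 < eps -> 0 < delta ->
  \forall n \near \oo, forall gT : finGroupType, #|gT| = n ->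
  Pcov R gT (Num.truncn ((1 - eps) *
    Num.sqrt (Theta R gT * #|gT|%:R * ln (#|gT|%:R : R)))) <= delta.
Proof.
move=> eps0 delta0.
(* Here [66 = 2 + 64]: the exponent in [Pcov_le] will be at most [2 * h + 64 * h]. *)
pose h : R := ln (1 + delta / 2) / 66.
have h0 : 0 < h by rewrite divr_gt0 // ln_gt0; lra.
have hE : expR (66 * h) = 1 + delta / 2.
  have -> : 66 * h = ln (1 + delta / 2) by rewrite /h; field.
  by rewrite lnK // posrE; lra.
(* For [eps > 1] the argument of [truncn] is nonpositive and [k] is 0; capping [d] at 1 keeps
   [k ^ 2 <= (1 - d) * C ^ 2] true in that case. *)
pose d : R := Num.min eps 1.
have d0 : 0 < d by rewrite lt_min eps0 ltr01.
near=> n => gT gTn.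
have [/andP[t12 t1] _] := @Theta_spec R gT.
have n0 : 0 < #|gT|%:R :> R by rewrite ltr0n (card_finGroup_gt0 gT).
have l1 : 1 <= ln (#|gT|%:R : R) by rewrite gTn; near: n; exact: near_ln_ge.
set C := Num.sqrt _.
have C0 : 0 <= C by exact: sqrtr_ge0.
have C2 : C ^+ 2 = Theta R gT * #|gT|%:R * ln #|gT|%:R.
  by rewrite sqr_sqrtr // !mulr_ge0 ?(ltW n0) //; lra.
set k := Num.truncn _.
have k2 : (k%:R : R) ^+ 2 <= (1 - d) * C ^+ 2.
  case: (lerP eps 1) => eps1.
    have -> : d = eps by rewrite /d min_l.
    have kle : k%:R <= (1 - eps) * C by rewrite truncn_le mulr_ge0 //; lra.
    apply: (@le_trans _ _ (((1 - eps) * C) ^+ 2)).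
      by rewrite lerXn2r ?nnegrE // (le_trans _ kle).
    rewrite exprMn ler_wpM2r ?sqr_ge0 // expr2 ler_piMl //; lra.
  have -> : d = 1 by rewrite /d min_r // ltW.
  have -> : k = 0%N.
    by apply/truncn0Pn; rewrite -ltNge (le_lt_trans _ ltr01) // mulr_le0_ge0 //; lra.
  by rewrite subrr mul0r expr0n.
have k2le : (k%:R : R) ^+ 2 <= 1 * (#|gT|%:R * ln #|gT|%:R).
  apply: (le_trans k2).
  have -> : (1 - d) * C ^+ 2 = (1 - d) * Theta R gT * (#|gT|%:R * ln #|gT|%:R).
    by rewrite C2; ring.
  apply: ler_wpM2r.
    by rewrite mulr_ge0 ?(ltW n0) //; lra.
  by rewrite mulr_ile1 // /d; case: (lerP eps 1) => ?; lra.
have [small1 small2] : 2 * k%:R / #|gT|%:R <= Num.min 2^-1 h /\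
    k%:R ^+ 3 / #|gT|%:R ^+ 2 <= Num.min 2^-1 h.
  rewrite gTn; rewrite gTn in k2le.
  move: (k%:R : R) (ler0n R k) k2le; near: n; apply: near_lt_sqr_le => //.
  by rewrite lt_min h0 invr_gt0 ltr0n.
move: small1 small2; rewrite !le_min => /andP[small _] /andP[_ Eh].
(* Large enough that [2 * L / w <= 2 * h], yet only logarithmic, so that [w + 1] is negligible
   against [expected_missed], which is at least [n] to the power [d / 2]. *)
pose w : R := ln #|gT|%:R / h.
have w0 : 0 < w by rewrite divr_gt0 //; lra.
have L_le : k%:R ^+ 2 / #|gT|%:R <= (1 - d) * (Theta R gT * ln #|gT|%:R).
  by rewrite ler_pdivrMr // (le_trans k2) // C2; lra.
have S_ge := expected_missed_ge (ltW d0) L_le.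
apply: le_trans (Pcov_le k w w0 small) _.
have L1 : k%:R ^+ 2 / #|gT|%:R <= ln #|gT|%:R :> R.
  by rewrite ler_pdivrMr // (le_trans k2le) // mul1r [leRHS]mulrC.
have e1 : expR (2 * (k%:R ^+ 2 / #|gT|%:R) / w + 64 * (k%:R ^+ 3 / #|gT|%:R ^+ 2)) <=
    1 + delta / 2.
  rewrite -hE ler_expR.
  have : 2 * (k%:R ^+ 2 / #|gT|%:R) / w <= 2 * h.
    rewrite -mulrA ler_wpM2l // ler_pdivrMr //.
    by have -> : h * w = ln #|gT|%:R by rewrite /w; field; rewrite gt_eqF.
  by move: Eh; lra.
have e2 : expR (16 * (k%:R ^+ 3 / #|gT|%:R ^+ 2)) <= 1 + delta / 2.
  by rewrite -hE ler_expR; lra.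
have e3 : (w + 1) * expR (16 * (k%:R ^+ 3 / #|gT|%:R ^+ 2)) /
    expected_missed gT (k%:R ^+ 2 / #|gT|%:R) <= delta / 2.
  rewrite ler_pdivrMr; last exact: lt_le_trans (expR_gt0 _) S_ge.
  apply: le_trans (ler_wpM2l _ S_ge); last by lra.
  have near1 : (h^-1 + 1) * (1 + delta / 2) * ln (#|gT|%:R : R) ^+ 1 <=
      delta / 2 * expR (d / 2 * ln #|gT|%:R).
    by rewrite gTn; near: n; apply: near_ln_pow_le; rewrite divr_gt0.
  apply: le_trans near1; rewrite expr1 [leRHS]mulrAC.
  apply: ler_pM => //; rewrite ?expR_ge0 ?addr_ge0 ?(ltW w0) //.
  by rewrite [leRHS]mulrDl mul1r /w [_ / h]mulrC lerD2l.
by lra.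
Unshelve. all: by end_near. Qed.

Theorem theorem1p1 (R : realType) (G : nat -> finGroupType)
  (hG : forall M : nat, exists N : nat, forall n : nat, (N <= n)%N -> (M <= #|G n|)%N)
  (eps : R) (heps : 0 < eps) :
  let C := fun n : nat =>
    Num.sqrt (Theta R (G n) * (#|G n|)%:R * ln ((#|G n|)%:R : R)) in
  ((fun n => Pcov R (G n) `|Num.ceil ((1 + eps) * C n)|%N) @ \oo --> (1 : R))
  /\ ((fun n => Pcov R (G n) (Num.truncn ((1 - eps) * C n))) @ \oo --> (0 : R)).
Proof.
move=> C; split; apply/cvgrPdist_le => delta delta0.
  have [M _ hM] := near_Pcov_ge _ _ heps delta0.
  have [N hN] := hG M; exists N => // n /= Nn.
  have /andP[_ P1] := @Pcov_itv R (G n) `|Num.ceil ((1 + eps) * C n)|%N.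
  by rewrite ger0_norm ?subr_ge0 // lerBlDr -lerBlDl; apply: (hM _ (hN n Nn)).
have [M _ hM] := near_Pcov_le _ _ heps delta0.
have [N hN] := hG M; exists N => // n /= Nn.
have /andP[P0 _] := @Pcov_itv R (G n) (Num.truncn ((1 - eps) * C n)).
by rewrite sub0r normrN ger0_norm //; apply: (hM _ (hN n Nn)).
Qed.
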